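(* Let $p\in(1,2]$ and let $\varphi:\mathbb{R}^n\to\mathbb{R}\cup\{+\infty\}$ be proper and lower semicontinuous. Suppose $\bar x=0$ is a $p$-calm point of $\varphi$ with constant $M>0$, $\varphi(0)=0$, and $\varphi$ is $q$-prox-regular with some $q\ge2$ at $\bar x=0$ for $\bar\zeta=0\in\partial\varphi(0)$ with constants $\varepsilon<\frac12$ and $\rho>0$. Then for each $\gamma\in\big(0,\min\{\frac{2^{1-p}}{Mp},\frac{\kappa_p(2\varepsilon)^{p-2}}{\rho}\}\big)$ there exists a neighborhood $U\subseteq\mathbb{B}(0;\varepsilon)$ such that $$\|\operatorname{prox}^p_{\gamma\varphi}(x_2)-\operatorname{prox}^p_{\gamma\varphi}(x_1)\|\le L_p\|x_2-x_1\|^{1/q}\quad\forall x_1,x_2\in U,$$ and $\varphi^p_\gamma$ is differentiable on $U$ with $$\|\nabla\varphi^p_\gamma(x_2)-\nabla\varphi^p_\gamma(x_1)\|\le\mathcal{L}_p\|x_2-x_1\|^{\frac{p-1}{q}}\quad\forall x_1,x_2\in U,$$ where $L_p:=\Big(\frac{4\varepsilon(\kappa_p+1)}{\kappa_p-\rho\gamma(2\varepsilon)^{2-p}}\Big)^{1/q}$ and $\mathcal{L}_p:=\frac{2^{2-p}}{\gamma}\big((2\varepsilon)^{\frac{q-1}{q}}+L_p\big)^{p-1}$.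
   Context: $\operatorname{prox}^p_{\gamma\varphi}(x):=\operatorname{argmin}_{y}\big(\varphi(y)+\frac{1}{p\gamma}\|x-y\|^p\big)$ (single-valued on $U$ under the conclusion), $\varphi^p_\gamma(x):=\inf_y\big(\varphi(y)+\frac{1}{p\gamma}\|x-y\|^p\big)$. $\bar x$ is a $p$-calm point with constant $M>0$ if $\varphi(x)+M\|x-\bar x\|^p>\varphi(\bar x)$ for all $x\neq\bar x$. $\partial$ is the Mordukhovich (limiting) subdifferential. $\varphi$ is $q$-prox-regular ($q\ge2$) at $\bar x$ for $\bar\zeta\in\partial\varphi(\bar x)$ with constants $\varepsilon>0,\rho\ge0$ if $\varphi(x')\ge\varphi(x)+\langle\zeta,x'-x\rangle-\frac\rho2\|x'-x\|^q$ for all $x'\in\mathbb{B}(\bar x;\varepsilon)$, whenever $x\in\mathbb{B}(\bar x;\varepsilon)$, $\zeta\in\partial\varphi(x)\cap\mathbb{B}(\bar\zeta;\varepsilon)$, $\varphi(x)<\varphi(\bar x)+\varepsilon$. The constant $\kappa_t$ ($t\in(1,2]$) is: $\kappa_t=\frac{(2+\sqrt3)(t-1)}{16}$ for $t\in(1,\hat t]$, $\kappa_t=\frac{2+\sqrt3}{16}(1-(3-\sqrt3)^{1-t})$ for $t\in[\hat t,2)$, $\kappa_2=1$, where $\hat t\approx1.3214$ solves $\frac{t(t-1)}2=1-\big[1+\frac{(2-\sqrt3)t}{t-1}\big]^{1-t}$ on $(1,2]$. *)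

(* Defs.v *)
From HB Require Import structures.
From mathcomp Require Import all_boot all_order all_algebra.
From mathcomp Require Import all_classical all_reals all_analysis.
Set Implicit Arguments. Unset Strict Implicit. Unset Printing Implicit Defensive.
Import Order.TTheory GRing.Theory Num.Theory.
Local Open Scope classical_set_scope.
Local Open Scope ring_scope.

Section Defs.
Variables (R : realType) (n : nat).
Local Notation V := 'rV[R]_n.

Definition dotp (x y : V) : R := \sum_(i < n) x ord0 i * y ord0 i.
Definition enorm (x : V) : R := Num.sqrt (dotp x x).

Definition cball (c : V) (r : R) : set V := [set x | enorm (x - c) <= r].

Definition eopen (U : set V) : Prop :=
  forall x, U x -> exists r, 0 < r /\ forall y, enorm (y - x) < r -> U y.

Definition vcvg (u : nat -> V) (x : V) : Prop :=
  forall e, 0 < e -> exists N, forall k, (N <= k)%N -> enorm (u k - x) < e.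

Definition proper_fun (f : V -> \bar R) : Prop :=
  (forall x, -oo < f x)%E /\ exists x, (f x < +oo)%E.

Definition lsc (f : V -> \bar R) : Prop :=
  forall x (t : R), (t%:E < f x)%E ->
    exists d, 0 < d /\ forall y, enorm (y - x) < d -> (t%:E < f y)%E.

(* Frechet (regular) subdifferential: z \in \hat\partial f(x), i.e.
   liminf_{y->x} (f y - f x - <z,y-x>)/|y-x| >= 0, with f x finite *)
Definition frechet_subdiff (f : V -> \bar R) (x z : V) : Prop :=
  f x \is a fin_num /\
  forall e, 0 < e -> exists d, 0 < d /\ forall y, enorm (y - x) < d ->
    (f x + (dotp z (y - x) - e * enorm (y - x))%:E <= f y)%E.

Definition limiting_subdiff (f : V -> \bar R) (x z : V) : Prop :=
  f x \is a fin_num /\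
  exists (xs zs : nat -> V),
    vcvg xs x /\ vcvg zs z /\ (forall k, frechet_subdiff f (xs k) (zs k)) /\
    (forall e, 0 < e -> exists N, forall k, (N <= k)%N ->
        `|fine (f (xs k)) - fine (f x)| < e).

Definition p_calm (f : V -> \bar R) (xbar : V) (M p : R) : Prop :=
  forall x, x != xbar -> (f xbar < f x + (M * enorm (x - xbar) `^ p)%:E)%E.

Definition prox_regular (f : V -> \bar R) (xbar zbar : V) (q eps rho : R) : Prop :=
  forall x z, enorm (x - xbar) <= eps -> limiting_subdiff f x z ->
    enorm (z - zbar) <= eps -> (f x < f xbar + eps%:E)%E ->
    forall x', enorm (x' - xbar) <= eps ->
      (f x + (dotp z (x' - x) - rho / 2 * enorm (x' - x) `^ q)%:E <= f x')%E.

Definition moreau_env (f : V -> \bar R) (p g : R) (x : V) : \bar R :=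
  ereal_inf (range (fun y => f y + (enorm (x - y) `^ p / (p * g))%:E)%E).

Definition prox_set (f : V -> \bar R) (p g : R) (x : V) : set V :=
  [set y | forall z, (f y + (enorm (x - y) `^ p / (p * g))%:E
                      <= f z + (enorm (x - z) `^ p / (p * g))%:E)%E].

Definition frechet_grad (h : V -> \bar R) (x G : V) : Prop :=
  h x \is a fin_num /\
  forall e, 0 < e -> exists d, 0 < d /\ forall y, enorm (y - x) < d ->
    h y \is a fin_num /\
    `|fine (h y) - fine (h x) - dotp G (y - x)| <= e * enorm (y - x).

End Defs.

Definition t_hat (R : realType) : R :=
  xget 0 [set t : R | 1 < t <= 2 /\
     t * (t - 1) / 2 = 1 - (1 + (2 - Num.sqrt 3) * t / (t - 1)) `^ (1 - t)].

Definition kappa (R : realType) (t : R) : R :=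
  if t == 2 then 1
  else if t <= t_hat R then (2 + Num.sqrt 3) * (t - 1) / 16
  else (2 + Num.sqrt 3) / 16 * (1 - (3 - Num.sqrt 3) `^ (1 - t)).

(* Main.v *)
(* Let J u = |u|^(p-2) u (dmap p u below) be the gradient of |.|^p / p.  A minimizer y at x satisfies
   J(x - y) / gamma \in \partial phi(y), and calmness confines y, x - y and
   J(x - y) to small balls when x is close to 0.  Adding the prox-regularity
   inequalities at two minimizers bounds
   <J(x1 - y1) - J(x2 - y2), y1 - y2> from below by - rho gamma |y1 - y2|^q,
   and strong monotonicity of J on balls, with modulus (p-1) r^(p-2) on the ball
   of radius r, turns this into the Hoelder bound on the proximal map; only
   kappa_p <= p - 1 matters.  Convexity of |.|^p sandwiches the increments of the
   envelope between two expressions with the common derivative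
   J(x - prox x) / gamma, and J is (p-1)-Hoelder with constant 2^(2-p). *)
Require Import Defs.
From HB Require Import structures.
From mathcomp Require Import all_boot all_order all_algebra.
From mathcomp Require Import all_classical all_reals all_analysis.
From mathcomp Require Import ring lra.
Import Order.TTheory GRing.Theory Num.Theory.
Import numFieldNormedType.Exports.
Local Open Scope classical_set_scope.
Local Open Scope ring_scope.

Set Implicit Arguments.
Unset Strict Implicit.

(** * Power inequalities for nonnegative reals: concavity, subadditivity, Young *)

Section PowR.
Variable R : realType.
Implicit Types a b t x y m r l p : R.

Lemma powR_bernoulli a t : 0 < a <= 1 -> 0 <= t -> t `^ a <= 1 + a * (t - 1).
Proof.
move=> /andP[a0]; rewrite le_eqVlt => /orP[/eqP->|a1] t0.
  by rewrite powRr1//; lra.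
have h : 0 < 1 - a by lra.
have := @conjugate_powR R (t `^ a) 1 a^-1 (1 - a)^-1 (powR_ge0 _ _) ler01.
rewrite !invr_gt0 !invrK a0 h => /(_ isT isT).
have -> : a + (1 - a) = 1 by lra.
move=> /(_ erefl); rewrite mulr1 powR1 -powRrM divff ?gt_eqF// powRr1//.
by move=> h2; apply: le_trans h2 _; lra.
Qed.

Lemma powR_tangent a m x : 0 < a <= 1 -> 0 < m -> 0 <= x ->
  x `^ a <= m `^ a + a * m `^ (a - 1) * (x - m).
Proof.
move=> a01 m0 x0.
have := powR_bernoulli a01 (divr_ge0 x0 (ltW m0)).
have ma : 0 < m `^ a by exact: powR_gt0.
have -> : x `^ a = m `^ a * (x / m) `^ a.
  by rewrite -powRM ?divr_ge0 ?(ltW m0)// mulrCA divff ?gt_eqF// mulr1.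
rewrite -(ler_pM2l ma) => h; apply: le_trans h _.
have mN : m != 0 by rewrite gt_eqF.
rewrite powRB ?mN ?implybT// powRr1 ?(ltW m0)//.
have -> : m `^ a * (1 + a * (x / m - 1)) = m `^ a + a * (m `^ a / m) * (x - m).
  by field; rewrite gt_eqF.
by [].
Qed.

(** Average the tangent bounds at the barycenter [m]: the slope terms cancel. If m = 0, both
    weighted terms vanish. *)
Lemma powR_concave a l x y : 0 < a <= 1 -> 0 <= l <= 1 -> 0 <= x -> 0 <= y ->
  l * x `^ a + (1 - l) * y `^ a <= (l * x + (1 - l) * y) `^ a.
Proof.
move=> a01 /andP[l0 l1] x0 y0; set m := _ + _ * y.
have a0 : a != 0 by case/andP: a01 => a0 _; rewrite gt_eqF.
have l1' : 0 <= 1 - l by lra.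
have [m0|m0] := ltP 0 m.
  have hx := ler_wpM2l l0 (powR_tangent a01 m0 x0).
  have hy := ler_wpM2l l1' (powR_tangent a01 m0 y0).
  apply: le_trans (lerD hx hy) _; rewrite le_eqVlt; apply/orP; left; apply/eqP.
  by rewrite /m; ring.
have lx : 0 <= l * x by exact: mulr_ge0.
have ly : 0 <= (1 - l) * y by exact: mulr_ge0.
have /eqP : l * x = 0 by move: m0; rewrite /m; lra.
have /eqP : (1 - l) * y = 0 by move: m0; rewrite /m; lra.
rewrite !mulf_eq0 => /orP[]/eqP-> /orP[]/eqP->; rewrite ?powR0// ?mulr0 ?mul0r ?addr0 ?powR_ge0//.
Qed.

(** For z = x and z = y the ratio z/(x+y) is at most 1, hence at most its a-th power; the two ratios
    sum to 1. *)
Lemma powR_subadditive a x y : 0 < a <= 1 -> 0 <= x -> 0 <= y ->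
  (x + y) `^ a <= x `^ a + y `^ a.
Proof.
move=> /andP[a0 a1] x0 y0.
have [s0|] := ltP 0 (x + y); last first.
  move=> s0; have -> : x = 0 by lra. have -> : y = 0 by lra.
  by rewrite addr0 ler_wpDr ?powR_ge0.
have sa : 0 < (x + y) `^ a by exact: powR_gt0.
have key z : 0 <= z -> z <= x + y -> (z / (x + y)) * (x + y) `^ a <= z `^ a.
  rewrite le_eqVlt => /orP[/eqP <-|z0] zs; first by rewrite !mul0r powR_ge0.
  have -> : z `^ a = (z / (x + y)) `^ a * (x + y) `^ a.
    by rewrite -powRM ?divr_ge0 ?(ltW s0) ?(ltW z0)// divfK ?gt_eqF.
  rewrite ler_pM2r//; apply: ger1_powR => //.
  by rewrite divr_gt0//= ler_pdivrMr// mul1r.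
have hx : x <= x + y by rewrite lerDl.
have hy : y <= x + y by rewrite lerDr.
apply: le_trans (lerD (key x x0 hx) (key y y0 hy)).
by rewrite -mulrDl -mulrDl divff ?gt_eqF// mul1r.
Qed.

Lemma powR_mean a x y : 0 < a <= 1 -> 0 <= x -> 0 <= y ->
  x `^ a + y `^ a <= 2 `^ (1 - a) * (x + y) `^ a.
Proof.
move=> a01 x0 y0.
have h : 0 <= (2^-1 : R) <= 1 by apply/andP; split; lra.
have := powR_concave a01 h x0 y0.
have -> : 1 - 2^-1 = 2^-1 :> R by lra.
rewrite -!mulrDr powRM ?addr_ge0 ?invr_ge0//.
rewrite -(powR_inv1 (ler0n _ 2)) -powRrM mulN1r (powR_inv1 (ler0n _ 2)).
rewrite ler_pdivrMl// powRB ?pnatr_eq0 ?implybT// powRr1// powRN mulrA.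
by [].
Qed.

(** Obtained from [powR_mean] with exponent 1/p at [x]^ p[and]y [^ p], raised to the power [p]. *)
Lemma powR_convex_mean p x y : 1 <= p -> 0 <= x -> 0 <= y ->
  (x + y) `^ p <= 2 `^ (p - 1) * (x `^ p + y `^ p).
Proof.
move=> p1 x0 y0; have p0 : 0 < p by lra.
have pV : 0 < p^-1 <= 1 by rewrite invr_gt0 p0 invf_le1.
have := powR_mean pV (powR_ge0 x p) (powR_ge0 y p).
rewrite -!(powRrM _ p) divff ?gt_eqF// !powRr1// => h.
have hR : 0 <= 2 `^ (1 - p^-1) * (x `^ p + y `^ p) `^ p^-1.
  by rewrite mulr_ge0 ?powR_ge0.
apply: le_trans (ge0_ler_powR (ltW p0) _ _ h) _; rewrite ?nnegrE ?addr_ge0//.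
rewrite powRM ?powR_ge0// -!powRrM mulVf ?gt_eqF// powRr1 ?addr_ge0 ?powR_ge0//.
by rewrite mulrBl mul1r mulVf ?gt_eqF.
Qed.

Lemma powR_distB a x y : 0 < a <= 1 -> 0 <= x -> 0 <= y ->
  `|x `^ a - y `^ a| <= `|x - y| `^ a.
Proof.
move=> a01; case/andP: (a01) => a0 _.
wlog yx : x y / y <= x => [hw x0 y0|x0 y0].
  by have [/hw|/ltW/hw] := leP y x; [apply|rewrite distrC [`|x - y|]distrC; apply].
rewrite !ger0_norm ?subr_ge0//; last first.
  by apply: ge0_ler_powR; rewrite ?nnegrE// ltW.
rewrite lerBlDr -{1}(subrK y x); apply: powR_subadditive => //; rewrite subr_ge0//.
Qed.

Lemma powR_sqr a x : 0 <= x -> (x ^+ 2) `^ a = (x `^ a) ^+ 2.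
Proof.
by move=> x0; rewrite -(powR_mulrn 2 x0) -(powR_mulrn 2 (powR_ge0 _ _)) powRAC.
Qed.

Lemma powR_young p a b : 1 < p -> 0 <= a -> 0 <= b ->
  p * (a `^ (p - 1) * b) <= (p - 1) * a `^ p + b `^ p.
Proof.
move=> p1 a0 b0; have p0 : 0 < p by lra. have q0 : 0 < p - 1 by lra.
have := @conjugate_powR R (a `^ (p - 1)) b (p / (p - 1)) p (powR_ge0 _ _) b0.
rewrite divr_gt0// p0 invf_div => /(_ isT isT).
have -> : (p - 1) / p + p^-1 = 1 by field; rewrite gt_eqF.
move=> /(_ erefl); rewrite -powRrM [(p - 1) * _]mulrC divfK ?gt_eqF//.
rewrite -(ler_pM2l p0) => h; apply: le_trans h _.
rewrite le_eqVlt; apply/orP; left; apply/eqP; field.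
by rewrite !gt_eqF.
Qed.

End PowR.

(** * Euclidean inner product and norm on row vectors *)

Section Euclidean.
Variables (R : realType) (n : nat).
Local Notation V := 'rV[R]_n.
Implicit Types u v w x y z : V.

Lemma dotpC u v : dotp u v = dotp v u.
Proof. by apply: eq_bigr => i _; rewrite mulrC. Qed.

Lemma dotpDl u v w : dotp (u + v) w = dotp u w + dotp v w.
Proof. by rewrite -big_split; apply: eq_bigr => i _; rewrite mxE mulrDl. Qed.

Lemma dotpZl (a : R) u v : dotp (a *: u) v = a * dotp u v.
Proof. by rewrite mulr_sumr; apply: eq_bigr => i _; rewrite mxE mulrA. Qed.

Lemma dotpNl u v : dotp (- u) v = - dotp u v.
Proof. by rewrite -scaleN1r dotpZl mulN1r. Qed.

Lemma dotpBl u v w : dotp (u - v) w = dotp u w - dotp v w.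
Proof. by rewrite dotpDl dotpNl. Qed.

Lemma dotpZr (a : R) u v : dotp v (a *: u) = a * dotp v u.
Proof. by rewrite dotpC dotpZl dotpC. Qed.

Lemma dotpNr u v : dotp v (- u) = - dotp v u.
Proof. by rewrite dotpC dotpNl dotpC. Qed.

Lemma dotpBr u v w : dotp w (u - v) = dotp w u - dotp w v.
Proof. by rewrite dotpC dotpBl !(dotpC w). Qed.

Lemma dotp_ge0 u : 0 <= dotp u u.
Proof. by apply: sumr_ge0 => i _; rewrite -expr2 sqr_ge0. Qed.

Lemma enorm_ge0 u : 0 <= enorm u.
Proof. exact: sqrtr_ge0. Qed.
#[local] Hint Resolve enorm_ge0 : core.

Lemma enorm_sqr u : enorm u ^+ 2 = dotp u u.
Proof. by rewrite sqr_sqrtr ?dotp_ge0. Qed.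

Lemma coord_le_enorm u i : `|u ord0 i| <= enorm u.
Proof.
rewrite -sqrtr_sqr; apply: ler_wsqrtr; rewrite /dotp (bigD1 i)//= expr2 lerDl.
by apply: sumr_ge0 => j _; rewrite -expr2 sqr_ge0.
Qed.

Lemma enorm_eq0 u : (enorm u == 0) = (u == 0).
Proof.
apply/eqP/eqP => [u0|->]; last first.
  by rewrite /enorm /dotp big1 ?sqrtr0// => i _; rewrite mxE mul0r.
apply/rowP => i; rewrite mxE; apply/eqP; rewrite -normr_le0 -u0.
exact: coord_le_enorm.
Qed.

Lemma enorm0 : enorm (0 : V) = 0.
Proof. by apply/eqP; rewrite enorm_eq0. Qed.

Lemma enorm_gt0 u : (0 < enorm u) = (u != 0).
Proof. by rewrite lt_def enorm_eq0 enorm_ge0 andbT. Qed.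

Lemma enormZ (a : R) u : enorm (a *: u) = `|a| * enorm u.
Proof.
rewrite /enorm dotpZl dotpZr mulrA -expr2 sqrtrM ?sqr_ge0//.
by rewrite sqrtr_sqr.
Qed.

Lemma enormN u : enorm (- u) = enorm u.
Proof. by rewrite -scaleN1r enormZ normrN1 mul1r. Qed.

Lemma enormBC u v : enorm (u - v) = enorm (v - u).
Proof. by rewrite -enormN opprB. Qed.

Lemma enormB_sqr u v :
  enorm (u - v) ^+ 2 = enorm u ^+ 2 + enorm v ^+ 2 - 2 * dotp u v.
Proof. by rewrite !enorm_sqr dotpBl !dotpBr (dotpC v u); ring. Qed.

(** Cauchy-Schwarz, by expanding the square of the norm of |v| u - |u| v and cancelling 2 |u|
    |v|. *)
Lemma dotp_le_enorm u v : dotp u v <= enorm u * enorm v.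
Proof.
have [->|u0] := eqVneq u 0; first by rewrite -(scale0r 0) dotpZl mul0r mulr_ge0.
have [->|v0] := eqVneq v 0; first by rewrite -(scale0r 0) dotpZr mul0r mulr_ge0.
move: u0 v0; rewrite -!enorm_gt0 => u0 v0.
have uv0 : 0 < enorm u * enorm v by exact: mulr_gt0.
rewrite -subr_ge0 -(pmulr_rge0 _ uv0) -(pmulr_rge0 _ (ltr0n R 2)).
have := enormB_sqr (enorm v *: u) (enorm u *: v).
rewrite !enormZ dotpZl dotpZr !ger0_norm//.
have := sqr_ge0 (enorm (enorm v *: u - enorm u *: v)).
by move=> h E; move: h; rewrite E; congr (_ <= _); ring.
Qed.

Lemma dotp_ge_enorm u v : - (enorm u * enorm v) <= dotp u v.
Proof. by rewrite lerNl -dotpNl -(enormN u) dotp_le_enorm. Qed.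

Lemma enormD_le u v : enorm (u + v) <= enorm u + enorm v.
Proof.
rewrite -(@ler_pXn2r _ 2) ?nnegrE ?addr_ge0//.
have := enormB_sqr u (- v); rewrite opprK enormN => ->.
by have := dotp_ge_enorm u (- v); rewrite enormN; nra.
Qed.

Lemma enormB_le u v : enorm (u - v) <= enorm u + enorm v.
Proof. by rewrite -(enormN v) enormD_le. Qed.

Lemma enorm_le_dist u v : enorm v <= enorm (u - v) + enorm u.
Proof. by rewrite enormBC -[X in enorm X <= _](subrK u) enormD_le. Qed.

Lemma enorm_le_sum u : enorm u <= \sum_(i < n) `|u ord0 i|.
Proof.
have s0 : 0 <= \sum_(i < n) `|u ord0 i| by apply: sumr_ge0.
rewrite -(@ler_pXn2r _ 2) ?nnegrE// enorm_sqr expr2 mulr_suml.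
apply: ler_sum => i _; apply: le_trans (ler_norm _) _; rewrite normrM.
by apply: ler_wpM2l => //; rewrite (bigD1 i)//= lerDl sumr_ge0.
Qed.

(** * Strong monotonicity and Hoelder continuity of the gradient of |.|^p / p *)

Section DualityMap.
Variable p : R.
Hypothesis p12 : 1 < p <= 2.

Lemma p1_gt0_le1 : 0 < p - 1 <= 1.
Proof. by case/andP: p12 => a b; apply/andP; split; lra. Qed.

Definition dmap u : V := enorm u `^ (p - 2) *: u.

Lemma mulr_powR_p2 (a : R) : 0 <= a -> a `^ (p - 2) * a = a `^ (p - 1).
Proof.
move=> a0; have /andP[h _] := p1_gt0_le1.
have -> : p - 2 = p - 1 - 1 by ring.
by rewrite mulrC mulr_powRB1.
Qed.

Lemma mulr_powR_p1 (a : R) : 0 <= a -> a `^ (p - 1) * a = a `^ p.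
Proof. by move=> a0; rewrite mulrC mulr_powRB1//; case/andP: p12; lra. Qed.

Lemma dmap0 : dmap 0 = 0.
Proof. by rewrite /dmap scaler0. Qed.

Lemma enorm_dmap u : enorm (dmap u) = enorm u `^ (p - 1).
Proof. by rewrite enormZ ger0_norm ?powR_ge0// mulr_powR_p2. Qed.

Lemma dotp_dmap u : dotp (dmap u) u = enorm u `^ p.
Proof. by rewrite dotpZl -enorm_sqr expr2 mulrA mulr_powR_p2// mulr_powR_p1. Qed.

(** Cauchy-Schwarz and Young bound p <J u, v> by (p-1) |u|^p + |v|^p, while <J u, u> = |u|^p. *)
Lemma powR_enorm_subgradient u v :
  enorm u `^ p + p * dotp (dmap u) (v - u) <= enorm v `^ p.
Proof.
have p1 : 1 < p by case/andP: p12.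
have := powR_young p1 (enorm_ge0 u) (enorm_ge0 v).
have := dotp_le_enorm (dmap u) v; rewrite enorm_dmap.
rewrite dotpBr dotp_dmap.
move: (dotp _ v) (_ `^ (p - 1) * _) (_ `^ p) (_ `^ p).
by clear -p1 => *; nra.
Qed.

(** For fixed norms a, b the difference of the two sides is affine in t = <u, v>. Its slope has the
    sign that makes t = ab the worst case, because r^(p-2) bounds both a^(p-2) and b^(p-2) from
    below; [step] is that collinear case. *)
Lemma dmap_strongly_monotone (r : R) u v : enorm u <= r -> enorm v <= r ->
  (p - 1) * r `^ (p - 2) * enorm (u - v) ^+ 2 <= dotp (dmap u - dmap v) (u - v).
Proof.
have /andP[a0 a1] := p1_gt0_le1.
have powR_lb (x : R) : 0 < x -> x <= r -> r `^ (p - 2) <= x `^ (p - 2).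
  move=> x0 xr; have r0 : 0 < r by exact: lt_le_trans xr.
  have -> : p - 2 = - (2 - p) by ring.
  rewrite !powRN lef_pV2 ?posrE ?powR_gt0//.
  by apply: ge0_ler_powR; rewrite ?nnegrE ?(ltW x0) ?(ltW r0)//; lra.
(* [0 `^ (p - 2)] is a junk value, so the case of a zero vector is separate. *)
have sub0 w : enorm w <= r ->
    (p - 1) * r `^ (p - 2) * enorm w ^+ 2 <= dotp (dmap w) w.
  have [->|w0] := eqVneq w 0.
    by rewrite enorm0 expr0n mulr0 dotp_dmap powR_ge0.
  move=> wr; have ew : 0 < enorm w by rewrite enorm_gt0.
  rewrite dotpZl -enorm_sqr ler_pM2r ?exprn_gt0//.
  apply: le_trans (powR_lb _ ew wr).
  by rewrite ler_piMl ?powR_ge0.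
have [->|u0] := eqVneq u 0.
  by rewrite dmap0 !sub0r enormN dotpNl -dotpC dotpNl opprK dotpC => _ /sub0.
have [->|v0] := eqVneq v 0; first by rewrite dmap0 !subr0 => /sub0.
move: u0 v0; rewrite -!enorm_gt0.
have -> : dotp (dmap u - dmap v) (u - v) =
    enorm u `^ (p - 2) * enorm u ^+ 2 + enorm v `^ (p - 2) * enorm v ^+ 2
    - (enorm u `^ (p - 2) + enorm v `^ (p - 2)) * dotp u v.
  by rewrite dotpBl !dotpZl !dotpBr -!enorm_sqr (dotpC v u); ring.
rewrite enormB_sqr; have := dotp_le_enorm u v.
move: (enorm u) (enorm v) (dotp u v) => a b t tab a0' b0' ar br.
have hA := powR_lb _ a0' ar; have hB := powR_lb _ b0' br.
set C := r `^ _ in hA hB *.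
have C0 : 0 <= C by exact: powR_ge0.
have hC : (p - 1) * C <= C by rewrite ler_piMl.
have step : (a `^ (p - 2) * a - b `^ (p - 2) * b - (p - 1) * C * (a - b)) * (a - b) >= 0.
  clear tab t; wlog ba : a b a0' b0' ar br hA hB / b <= a => [hw|].
    have [/hw|/ltW/hw] := leP b a; first exact.
    move=> /(_ b0' a0' br ar hB hA); congr (_ <= _); ring.
  rewrite mulr_ge0 ?subr_ge0//.
  rewrite !mulr_powR_p2 ?(ltW a0') ?(ltW b0')//.
  (* The tangent at the larger norm gives a^(p-1) - b^(p-1) >= (p-1) a^(p-2) (a-b). *)
  have := powR_tangent p1_gt0_le1 a0' (ltW b0').
  have -> : p - 1 - 1 = p - 2 by ring.
  have : (p - 1) * C * (a - b) <= (p - 1) * a `^ (p - 2) * (a - b).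
    by rewrite ler_wpM2r ?subr_ge0// ler_wpM2l// ltW.
  by rewrite -subr_ge0; lra.
move: hA hB step; move: (a `^ _) (b `^ _) => A B hA hB step.
have : 0 <= (A + B - 2 * ((p - 1) * C)) * (a * b - t).
  by apply: mulr_ge0; lra.
rewrite -subr_ge0 in step *; nra.
Qed.

Lemma dmap_holder u v :
  enorm (dmap u - dmap v) <= 2 `^ (2 - p) * enorm (u - v) `^ (p - 1).
Proof.
have a01 := p1_gt0_le1; have /andP[a0 a1] := a01.
have k1 : 1 <= (2 : R) `^ (2 - p).
  by rewrite -[leLHS](powRr0 2); apply: ler_powR; lra.
have k2 : 2 - p = 1 - (p - 1) by ring.
have [->|u0] := eqVneq u 0.
  by rewrite dmap0 !sub0r !enormN enorm_dmap ler_peMl ?powR_ge0.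
have [->|v0] := eqVneq v 0.
  by rewrite dmap0 !subr0 enorm_dmap ler_peMl ?powR_ge0.
move: u0 v0; rewrite -!enorm_gt0 => u0 v0.
rewrite -(@ler_pXn2r _ 2) ?nnegrE ?mulr_ge0 ?powR_ge0//.
rewrite exprMn -(powR_sqr (p - 1))//.
rewrite !enormB_sqr !enorm_dmap dotpZl dotpZr.
have tl := dotp_ge_enorm u v; have tu := dotp_le_enorm u v.
move: (enorm u) (enorm v) (dotp u v) u0 v0 tl tu => a b t u0 v0 tl tu.
have ab0 : 0 < a * b by exact: mulr_gt0.
(* For fixed norms the squared left side is affine, and the squared right side
   concave, in the cosine 2 l - 1 of the angle: compare at l = 0 and l = 1. *)
pose l := (1 + t / (a * b)) / 2.
have tE : t = (2 * l - 1) * (a * b) by rewrite /l; field; rewrite !gt_eqF.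
have l0 : 0 <= l.
  by rewrite /l divr_ge0// -lerBlDl sub0r ler_pdivlMr// mulN1r.
have l1 : 0 <= 1 - l.
  have : t / (a * b) <= 1 by rewrite ler_pdivrMr// mul1r.
  by rewrite /l; lra.
have l01 : 0 <= l <= 1 by apply/andP; split; lra.
have := powR_concave a01 l01 (sqr_ge0 `|a - b|) (sqr_ge0 (a + b)).
have -> : l * `|a - b| ^+ 2 + (1 - l) * (a + b) ^+ 2 =
    a ^+ 2 + b ^+ 2 - 2 * t by rewrite real_normK ?num_real// tE; ring.
rewrite !(powR_sqr (p - 1)) ?addr_ge0 ?(ltW u0) ?(ltW v0)// => hc.
(* [h1] settles l = 1, parallel vectors; [h2] settles l = 0, opposite vectors, where the constant
   2^(2-p) arises. *)
have h1 := powR_distB a01 (ltW u0) (ltW v0).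
have h2 := powR_mean a01 (ltW u0) (ltW v0).
rewrite -k2 in h2; set k := 2 `^ _ in k1 h2 *.
have -> : a `^ (p - 2) * (b `^ (p - 2) * t) =
    (2 * l - 1) * (a `^ (p - 1) * b `^ (p - 1)).
  by rewrite tE -!mulr_powR_p2 ?(ltW u0) ?(ltW v0)//; ring.
set A := a `^ _ in h1 h2 *; set B := b `^ _ in h1 h2 *.
have A0 : 0 <= A by exact: powR_ge0.
have B0 : 0 <= B by exact: powR_ge0.
have -> : A ^+ 2 + B ^+ 2 - 2 * ((2 * l - 1) * (A * B)) =
    l * `|A - B| ^+ 2 + (1 - l) * (A + B) ^+ 2.
  by rewrite real_normK ?num_real//; ring.
have k0 : 0 <= k by exact: le_trans k1.
apply: le_trans (ler_wpM2l (sqr_ge0 k) hc).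
rewrite mulrDr; apply: lerD.
  rewrite [leRHS]mulrCA ler_wpM2l// -exprMn ler_pXn2r ?nnegrE ?mulr_ge0 ?powR_ge0//.
  by apply: le_trans h1 _; rewrite ler_peMl ?powR_ge0.
rewrite [leRHS]mulrCA ler_wpM2l// -exprMn ler_pXn2r ?nnegrE ?mulr_ge0 ?powR_ge0 ?addr_ge0//.
Qed.

(** The subgradient inequality based at [v], with J v replaced by J u at the Hoelder cost of
    [dmap_holder]. The remainder is of order |v - u|^p, hence o(|v - u|). *)
Lemma powR_enorm_upper u v :
  enorm v `^ p <= enorm u `^ p + p * dotp (dmap u) (v - u)
                  + p * (2 `^ (2 - p) * (enorm (v - u) `^ (p - 1) * enorm (v - u))).
Proof.
have p0 : 0 < p by case/andP: p12; lra.
have h := powR_enorm_subgradient v u.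
have E : dotp (dmap v) (u - v) =
    - dotp (dmap u) (v - u) - dotp (dmap v - dmap u) (v - u).
  by rewrite !(dotpBl, dotpBr); ring.
have hd := dotp_le_enorm (dmap v - dmap u) (v - u).
have hh := ler_wpM2r (enorm_ge0 (v - u)) (dmap_holder v u).
rewrite -mulrA in hh.
rewrite E in h.
have := ler_wpM2l (ltW p0) (le_trans hd hh).
move: h; move: (dotp _ _) (dotp _ _) (_ `^ p) (_ `^ p) (_ * (_ * enorm _)).
by clear => *; lra.
Qed.

End DualityMap.
End Euclidean.
#[global] Hint Extern 0 (is_true (0 <= enorm _)) => exact: enorm_ge0 : core.

Lemma kappa_le (R : realType) (p : R) : 1 < p <= 2 -> kappa p <= p - 1.
Proof.
move=> /andP[p1 p2]; rewrite /kappa.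
have s0 : 0 <= Num.sqrt (3 : R) by exact: sqrtr_ge0.
have s3 : Num.sqrt (3 : R) ^+ 2 = 3 by rewrite sqr_sqrtr.
set s := Num.sqrt _ in s0 s3 *.
have s2 : s < 2 by nra.
case: eqP => [->|_]; first by lra.
case: ifP => _; first by nra.
(* Uses 1 - e^-y <= y, ln (3 - s) <= 2 - s and (2 + s)(2 - s) = 1. *)
have h3 : 0 < 3 - s by lra.
rewrite /powR gt_eqF//.
have h1 := expR_ge1Dx ((1 - p) * ln (3 - s)).
have h2 : ln (3 - s) <= 2 - s.
  have -> : 3 - s = 1 + (2 - s) by ring.
  by apply: le_ln1Dx; lra.
have h4 : 1 - expR ((1 - p) * ln (3 - s)) <= (p - 1) * (2 - s) by nra.
have h5 : 0 <= (2 + s) / 16 by lra.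
have := ler_wpM2l h5 h4; nra.
Qed.

Lemma powR_small (R : realType) (a c e : R) : 0 < a -> 0 < c -> 0 < e ->
  exists2 d, 0 < d & forall t, 0 <= t -> t <= d -> c * t `^ a <= e.
Proof.
move=> a0 c0 e0; exists ((e / c) `^ a^-1); first by rewrite powR_gt0// divr_gt0.
move=> t t0 td; rewrite mulrC -ler_pdivlMr//.
have -> : e / c = ((e / c) `^ a^-1) `^ a.
  by rewrite -powRrM mulVf ?gt_eqF// powRr1// divr_ge0// ltW.
by apply: ge0_ler_powR; rewrite ?nnegrE ?powR_ge0// ltW.
Qed.

(** * Attainment of minima, optimality condition, gradient of the envelope *)

Section Minimizers.
Variables (R : realType) (n : nat).
Local Notation V := 'rV[R]_n.
Implicit Types (f : V -> \bar R) (x y z : V).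

(** Links Euclidean balls to the library topology, which uses coordinatewise balls. Radius d/(n+1)
    makes the sum of n coordinates strictly less than [d] and stays meaningful for n = 0. *)
Lemma nbhs_enorm x (d : R) : 0 < d -> nbhs x [set y | enorm (y - x) < d].
Proof.
move=> d0; apply/nbhs_ballP; exists (d / n.+1%:R) => /=; first by rewrite divr_gt0.
move=> y [_ xy] /=; apply: le_lt_trans (enorm_le_sum _) _.
apply: (@le_lt_trans _ _ (\sum_(i < n) (d / n.+1%:R))).
  apply: ler_sum => i _; rewrite !mxE ltW// distrC.
  exact: xy.
rewrite sumr_const card_ord -[_ *+ n]mulr_natr mulrAC -mulrA gtr_pMr//.
by rewrite ltr_pdivrMr// mul1r ltr_nat.
Qed.

(** If the infimum [m] is not attained, lower semicontinuity gives f > m + 1/(k+1) near each point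
    for all large k. Compactness of the cube [K] makes one k work on all of [K]; outside the ball f
    exceeds f x0, and x0 lies in [K]. So m + 1/(k+1) is a lower bound, a contradiction. *)
Lemma lsc_coercive_attains_min f (c r : R) x0 : lsc f ->
  (forall y, c%:E <= f y)%E -> (f x0 < +oo)%E -> enorm x0 <= r ->
  (forall y, r < enorm y -> (f x0 < f y)%E) ->
  exists y, forall z, (f y <= f z)%E.
Proof.
move=> lf fc fx0 x0r fr.
set m := ereal_inf (range f).
have mf y : (m <= f y)%E by apply: ereal_inf_lbound; exists y.
have cm : (c%:E <= m)%E by apply: le_ereal_inf_tmp => _ [y _ <-].
have mfin : m \is a fin_num.
  by rewrite fin_numElt (lt_le_trans (ltNyr c) cm) (le_lt_trans (mf x0) fx0).
apply: contrapT => hex.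
have mlt y : (m < f y)%E.
  rewrite lt_neqAle mf andbT; apply/eqP => my; apply: hex.
  by exists y => z; rewrite -my.
pose K := [set y : V | forall i, `[- r, r]%classic (y ord0 i)].
have Kr y : enorm y <= r -> K y.
  move=> yr i /=; rewrite in_itv/= -ler_norml.
  exact: le_trans (coord_le_enorm _ _) yr.
have cK : compact K.
  by apply: (@rV_compact _ _ (fun=> `[- r, r]%classic)) => i; exact: segment_compact.
pose Q (k : nat) y := ((fine m + k.+1%:R^-1)%:E < f y)%E.
have near_lt y : K y -> \forall z \near y & k \near \oo, Q k z.
  move=> _; have [t mt ty] : exists2 t, fine m < t & (t%:E < f y)%E.
    have := mlt y; rewrite -{1}(fineK mfin); case: (f y) => [s||]//=.
    - rewrite lte_fin => ms; exists ((fine m + s) / 2); rewrite ?lte_fin; lra.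
    - by move=> _; exists (fine m + 1); rewrite ?ltry//; lra.
  have [d [d0 yd]] := lf _ _ ty.
  have tm : 0 < t - fine m by lra.
  exists ([set z | enorm (z - y) < d], [set k | k.+1%:R^-1 < t - fine m]).
    by split; [exact: nbhs_enorm|exact: (near_infty_natSinv_lt (PosNum tm))].
  move=> [z k] /= [zy kt]; apply: lt_trans (yd _ zy).
  by rewrite lte_fin -ltrBrDl.
have /compact_near_coveringP/(_ _ _ Q _ near_lt)/filter_ex[k Kk] := cK.
have : ((fine m + k.+1%:R^-1)%:E <= m)%E.
  apply: le_ereal_inf_tmp => _ [y _ <-]; have [yr|/fr ry] := leP (enorm y) r.
    by apply/ltW/Kk/Kr.
  by apply/ltW/(lt_trans _ ry)/Kk/Kr.
by rewrite -{2}(fineK mfin) lee_fin gerDl lt_geF// invr_gt0.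
Qed.

Variable p : R.
Hypothesis p12 : 1 < p <= 2.

(** Only a lower bound on the power term near [y] is required, and its affine minorant at [y]
    supplies one. *)
Lemma lsc_add_powR_dist f (g : R) x : 0 < g -> (forall y, -oo < f y)%E -> lsc f ->
  lsc (fun y => f y + (enorm (x - y) `^ p / (p * g))%:E)%E.
Proof.
move=> g0 fNy lf y t /=.
have p0 : 0 < p by case/andP: p12; lra.
have pg : 0 < p * g by exact: mulr_gt0.
move=> tf; set D : R := enorm (x - y) `^ p / (p * g) in tf.
(* Half of the slack above [t] goes to [f], through t', and half to the power term, as its
   admissible drop [e]. *)
have [t' [e [e0 tt' t'f]]] : exists t' e, [/\ 0 < e, t = t' + D - e & (t'%:E < f y)%E].
  move: tf (fNy y); case: (f y) => [s||]//=.
  - rewrite -EFinD lte_fin => tf _; exists (t - D + (s + D - t) / 2), ((s + D - t) / 2).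
    by rewrite lte_fin; split; lra.
  - by move=> _ _; exists (t - D + 1), 1; rewrite ltry; split; lra.
have [d [d0 yd]] := lf _ _ t'f.
(* The added 1 keeps the divisor positive when the gradient vanishes. *)
pose b := enorm (dmap p (x - y)) + 1.
have b0 : 0 < b by rewrite /b ltr_pwDr.
exists (Num.min d (e * g / b)); split; first by rewrite lt_min d0 divr_gt0// mulr_gt0.
move=> z; rewrite lt_min => /andP[zd ze].
have := powR_enorm_subgradient p12 (x - y) (x - z).
have -> : x - z - (x - y) = y - z by rewrite opprB addrC addrA subrK.
have := dotp_ge_enorm (dmap p (x - y)) (y - z).
rewrite (enormBC y).
have : enorm (dmap p (x - y)) * enorm (z - y) <= e * g.
  apply: (@le_trans _ _ (b * enorm (z - y))); first by rewrite ler_wpM2r// lerDl.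
  by rewrite mulrC -ler_pdivlMr// ltW.
move=> h1 h2 h3.
have h4 : D - e <= enorm (x - z) `^ p / (p * g).
  rewrite ler_pdivlMr// mulrBl /D divfK ?gt_eqF//.
  move: h1 h2 h3; move: (_ * enorm _) (dotp _ _) (_ `^ _) (_ `^ _).
  move=> E X A B h1 h2 h3.
  have : - (e * g) <= X by lra.
  by rewrite -(ler_pM2l p0); lra.
have := yd _ zd; rewrite tt'.
move: h4; move: (enorm (x - z) `^ p / (p * g)) => Dz h4.
case: (f z) (fNy z) => [s| |] _ ts.
- by rewrite -EFinD lte_fin -addrA ltr_leD.
- by rewrite ltry.
- by [].
Qed.

(** Minimality bounds f z - f y below by (|x-y|^p - |x-z|^p) / (p g), and [powR_enorm_upper] expands
    this to first order at [y]. *)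
Lemma prox_frechet_subdiff f (g : R) x y : 0 < g -> f y \is a fin_num ->
  (forall z, -oo < f z)%E ->
  prox_set f p g x y -> frechet_subdiff f y (g^-1 *: dmap p (x - y)).
Proof.
move=> g0 fy fNy yx; split=> // e e0.
have /andP[a0 _] := p1_gt0_le1 p12.
have p0 : 0 < p by lra.
have c0 : 0 < 2 `^ (2 - p) / g by rewrite divr_gt0// powR_gt0.
have [d d0 hd] := powR_small a0 c0 e0.
exists d; split=> // z zd; have := hd _ (enorm_ge0 _) (ltW zd).
have := yx z; rewrite -(fineK fy); case: (f z) (fNy z) => [s||]// _; last by move=> _; rewrite leey.
rewrite -!EFinD !lee_fin => h1 h2.
have := powR_enorm_upper p12 (x - y) (x - z).
have -> : x - z - (x - y) = - (z - y).
  by rewrite !opprB addrC addrA subrK.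
rewrite enormN dotpNr (dotpZl g^-1) => h3.
have := ler_wpM2r (enorm_ge0 (z - y)) h2.
move: h1 h3; move: (dotp _ _) (enorm (z - y)) (_ `^ (p - 1)) (2 `^ _) (_ `^ p) (_ `^ p).
clear - g0 p0 => D E A k X Y h1 h3 h2'.
have : (X - Y) / (p * g) <= - (D / g) + k / g * A * E.
  rewrite ler_pdivrMr ?mulr_gt0//.
  have -> : (- (D / g) + k / g * A * E) * (p * g) = p * - D + p * (k * (A * E)).
    by field; rewrite gt_eqF.
  by lra.
rewrite mulrBl; lra.
Qed.

Lemma frechet_limiting f x z : frechet_subdiff f x z -> limiting_subdiff f x z.
Proof.
move=> h; split; first by case: h.
exists (fun=> x), (fun=> z); split; first by move=> e e0; exists 0%N => k _; rewrite subrr enorm0.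
split; first by move=> e e0; exists 0%N => k _; rewrite subrr enorm0.
by split=> // e e0; exists 0%N => k _; rewrite subrr normr0.
Qed.

Lemma moreau_env_prox f (g : R) x y : prox_set f p g x y -> f y \is a fin_num ->
  moreau_env f p g x = (fine (f y) + enorm (x - y) `^ p / (p * g))%:E.
Proof.
move=> yx fy; rewrite EFinD fineK//; apply/eqP; rewrite eq_le; apply/andP; split.
  by apply: ereal_inf_lbound; exists y.
by apply: le_ereal_inf_tmp => _ [z _ <-]; exact: yx.
Qed.

(** Testing the minimum at [y] with P x bounds the increment of the envelope above; testing the
    minimum at [x] with P y bounds it below, with slope J(x - P y) / g. Continuity of [P] at [x]
    makes this slope tend to J(x - P x) / g. *)
Lemma moreau_env_frechet_grad f (g : R) (P : V -> V) x : 0 < g ->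
  (exists2 d, 0 < d & forall y, enorm (y - x) < d ->
     prox_set f p g y (P y) /\ f (P y) \is a fin_num) ->
  (forall e, 0 < e -> exists2 d, 0 < d &
     forall y, enorm (y - x) < d -> enorm (P y - P x) <= e) ->
  frechet_grad (moreau_env f p g) x (g^-1 *: dmap p (x - P x)).
Proof.
move=> g0 [d0 d0_gt0 hP] cP.
have /andP[a0 _] := p1_gt0_le1 p12.
have p0 : 0 < p by lra.
have c0 : 0 < 2 `^ (2 - p) / g by rewrite divr_gt0// powR_gt0.
have xx : enorm (x - x) < d0 by rewrite subrr enorm0.
have [Px Pxf] := hP _ xx.
split; first by rewrite (moreau_env_prox Px Pxf).
move=> e e0; have [d1 d1_gt0 hd1] := powR_small a0 c0 e0.
have [d2 d2_gt0 hd2] := cP _ d1_gt0.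
exists (Num.min d0 (Num.min d1 d2)); split; first by rewrite !lt_min d0_gt0 d1_gt0.
move=> y; rewrite !lt_min => /and3P[yd0 yd1 yd2].
have [Py Pyf] := hP _ yd0.
split; first by rewrite (moreau_env_prox Py Pyf).
rewrite (moreau_env_prox Px Pxf) (moreau_env_prox Py Pyf).
have := Px (P y); have := Py (P x).
rewrite -(fineK Pxf) -(fineK Pyf); move: (fine (f (P x))) (fine (f (P y))) => s s'.
move=> h1 h2; rewrite -!EFinD lee_fin in h1; rewrite -!EFinD lee_fin in h2.
rewrite /fine.
have sub z : y - z - (x - z) = y - x by rewrite opprB addrA subrK.
have := powR_enorm_upper p12 (x - P x) (y - P x).
rewrite sub => h3.
have := powR_enorm_subgradient p12 (x - P y) (y - P y); rewrite sub => h4.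
have := dmap_holder p12 (x - P x) (x - P y).
have -> : x - P x - (x - P y) = P y - P x by rewrite opprB addrC addrA subrK.
move=> h5.
have := dotp_le_enorm (dmap p (x - P x) - dmap p (x - P y)) (y - x).
rewrite dotpBl (dotpZl g^-1) => h6.
have h7 := hd1 _ (enorm_ge0 _) (ltW yd1).
have h8 := hd1 _ (enorm_ge0 _) (hd2 _ yd2).
have h9 := ler_wpM2r (enorm_ge0 (y - x)) h7.
have : enorm (dmap p (x - P x) - dmap p (x - P y)) / g <= e.
  by apply: le_trans h8; rewrite mulrAC ler_pM2r ?invr_gt0.
move=> /(ler_wpM2r (enorm_ge0 (y - x))).
have gV : 0 < g^-1 by rewrite invr_gt0.
have pV : 0 < p^-1 by rewrite invr_gt0.
have pK : p^-1 * p = 1 by rewrite mulVf ?gt_eqF.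
move: h3 => /(ler_wpM2l (ltW pV)); rewrite !mulrDr !(mulrA p^-1 p) pK !mul1r => /(ler_wpM2l (ltW gV)).
move: h4 => /(ler_wpM2l (ltW pV)); rewrite !mulrDr !(mulrA p^-1 p) pK !mul1r => /(ler_wpM2l (ltW gV)).
move: h6 => /(ler_wpM2l (ltW gV)).
move: h1 h2 h9; rewrite !invfM ler_norml => h1 h2 h9 h6 h4 h3 h10.
move: h1 h2 h9 h6 h4 h3 h10; clear.
move: (dotp _ _) (dotp (dmap p (x - P y)) _) (enorm (dmap p _ - _)) (enorm (y - x) `^ (p - 1)).
move: (enorm (y - x)) (_ `^ p) (_ `^ p) (_ `^ p) (_ `^ p) (2 `^ _) (g^-1) (p^-1).
move=> *; apply/andP; split; lra.
Qed.

End Minimizers.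

(** * Hoelder estimate for proximal points from prox-regularity *)

Section Estimates.
Variables (R : realType) (n : nat) (p : R).
Hypothesis p12 : 1 < p <= 2.
Local Notation V := 'rV[R]_n.
Implicit Types (f : V -> \bar R) (x y z : V).

(** Scalar core of [monotone_holder]: there a = |y2-y1|, A = a^q, d = |x2-x1|, W is the norm of the
    difference of the residuals x_i - y_i, and c, c' are the powers p-2 and 2-p of 2 eps. In the
    constant 4 eps (k+1), the summand 4 eps comes from the bound on [Y] and 4 eps k from 2 k a d
    with a <= 2 eps. *)
Let monotone_holder_scalar (k b eps A X Y d a W c' c : R) :
  0 < eps -> 0 <= b -> k <= p - 1 ->
  (p - 1) * c * W ^+ 2 <= Y - X -> Y <= 2 * (c * (2 * eps)) * d ->
  a <= W + d -> 0 <= W -> a <= 2 * eps -> - (b * A) <= X -> A <= a ^+ 2 ->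
  0 <= a -> 0 <= d -> c * c' = 1 -> 0 < c -> 0 < c' -> b * c' < k ->
  A * (k - b * c') <= 4 * eps * (k + 1) * d.
Proof.
move=> e0 b0 kp hsm hx hW W0 a2 hmon aA a0 d0 cc c0 c'0 bk.
have k0 : 0 < k by apply: le_lt_trans bk; rewrite mulr_ge0// ltW.
(* If a > d, square W >= a - d; otherwise the left side is nonpositive. *)
have sq : a ^+ 2 - 2 * a * d <= W ^+ 2.
  have [ad|da] := leP a d; first by have := sqr_ge0 W; nra.
  by nra.
have h1 : k * (c * (a ^+ 2 - 2 * a * d)) <= (p - 1) * c * W ^+ 2.
  rewrite -[leRHS]mulrA; apply: (@le_trans _ _ (k * (c * W ^+ 2))).
    by rewrite (ler_pM2l k0) (ler_pM2l c0).
  by rewrite ler_wpM2r// mulr_ge0 ?sqr_ge0// ltW.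
have h2 : k * (c * (a ^+ 2 - 2 * a * d)) <= 2 * (c * (2 * eps)) * d + b * A by lra.
have := ler_wpM2r (ltW c'0) h2.
have -> : k * (c * (a ^+ 2 - 2 * a * d)) * c' = k * (a ^+ 2 - 2 * a * d) * (c * c') by ring.
have -> : (2 * (c * (2 * eps)) * d + b * A) * c' = 4 * eps * d * (c * c') + A * (b * c') by ring.
rewrite cc !mulr1 => h3.
have h4 : k * A <= k * a ^+ 2 by rewrite ler_pM2l.
have h5 : k * (a * d) <= k * (2 * eps * d) by rewrite ler_pM2l// ler_wpM2r.
lra.
Qed.

Lemma monotone_holder (k b q eps : R) x1 x2 y1 y2 :
  0 < eps -> eps < 1 / 2 -> 2 <= q -> 0 <= b -> k <= p - 1 ->
  b * (2 * eps) `^ (2 - p) < k ->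
  enorm (x1 - y1) <= 2 * eps -> enorm (x2 - y2) <= 2 * eps ->
  enorm (y2 - y1) <= 2 * eps ->
  - (b * enorm (y2 - y1) `^ q) <=
    dotp (dmap p (x1 - y1) - dmap p (x2 - y2)) (y1 - y2) ->
  enorm (y2 - y1) <=
  (4 * eps * (k + 1) / (k - b * (2 * eps) `^ (2 - p))) `^ (1 / q) *
    enorm (x2 - x1) `^ (1 / q).
Proof.
move=> e0 e12 q2 b0 kp bk u1 u2 a2 hmon.
have q0 : 0 < q by lra.
have E0 : 0 < 2 * eps by lra.
have /andP[p10 _] := p1_gt0_le1 p12.
have hsm := dmap_strongly_monotone p12 u1 u2.
have Jle (w : V) : enorm w <= 2 * eps -> enorm (dmap p w) <= (2 * eps) `^ (p - 2) * (2 * eps).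
  move=> wE; rewrite enorm_dmap// mulr_powR_p2 ?(ltW E0)//.
  by apply: ge0_ler_powR; rewrite ?nnegrE ?(ltW p10) ?(ltW E0).
have J1 := Jle _ u1; have J2 := Jle _ u2.
have uv : x1 - y1 - (x2 - y2) = (x1 - x2) - (y1 - y2).
  by rewrite !opprD !opprK addrACA.
rewrite uv dotpBr in hsm.
have hx : dotp (dmap p (x1 - y1) - dmap p (x2 - y2)) (x1 - x2) <=
    2 * ((2 * eps) `^ (p - 2) * (2 * eps)) * enorm (x2 - x1).
  apply: le_trans (dotp_le_enorm _ _) _; rewrite (enormBC x1) ler_wpM2r//.
  by apply: le_trans (enormB_le _ _) _; lra.
have hW : enorm (y2 - y1) <= enorm (x1 - x2 - (y1 - y2)) + enorm (x2 - x1).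
  rewrite (enormBC x2) (enormBC (x1 - x2)).
  have -> : y2 - y1 = - (y1 - y2 - (x1 - x2) + (x1 - x2)) by rewrite subrK opprB.
  by rewrite enormN enormD_le.
have W0 := enorm_ge0 (x1 - x2 - (y1 - y2)).
have cc : (2 * eps) `^ (p - 2) * (2 * eps) `^ (2 - p) = 1.
  have -> : 2 - p = - (p - 2) by ring.
  by rewrite powRN divff// gt_eqF// powR_gt0.
have c0 := powR_gt0 (p - 2) E0; have c'0 := powR_gt0 (2 - p) E0.
rewrite -powRM//; last first.
  rewrite divr_ge0// ?subr_ge0 ?(ltW bk)// !mulr_ge0// ?(ltW e0)//.
  by have := mulr_ge0 b0 (ltW c'0); lra.
have -> : enorm (y2 - y1) = (enorm (y2 - y1) `^ q) `^ (1 / q).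
  by rewrite -powRrM mul1r divff ?gt_eqF// powRr1.
(* As |y2-y1| <= 2 eps < 1, raising the exponent from 2 to [q] decreases the power. *)
have aq : enorm (y2 - y1) `^ q <= enorm (y2 - y1) ^+ 2.
  rewrite -(powR_mulrn 2)//; have [->|w0] := eqVneq (enorm (y2 - y1)) 0.
    by rewrite !powR0// gt_eqF.
  apply: ger_powR => //; rewrite lt_def w0 enorm_ge0/=; lra.
have aq0 := powR_ge0 (enorm (y2 - y1)) q.
apply: ge0_ler_powR; rewrite ?nnegrE ?powR_ge0//.
- by rewrite divr_ge0// ltW.
- rewrite mulr_ge0// divr_ge0// ?subr_ge0 ?(ltW bk)// !mulr_ge0// ?(ltW e0)//.
  by have := mulr_ge0 b0 (ltW c'0); lra.
rewrite mulrAC ler_pdivlMr ?subr_gt0//.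
have a0 := enorm_ge0 (y2 - y1); have d0 := enorm_ge0 (x2 - x1).
exact: (monotone_holder_scalar e0 b0 kp hsm hx hW W0 a2 hmon aq a0 d0 cc c0 c'0 bk).
Qed.

(** Prox-regularity at y1 tested with y2, and conversely: in the sum the values of [f] cancel, the
    two halves of [rho] add up, and multiplying by [g] clears the factor in the subgradients J(x-y)
    / g. *)
Lemma prox_regular_monotone f (q eps rho g : R) x1 x2 y1 y2 :
  0 < g -> f 0 = 0%E -> prox_regular f 0 0 q eps rho ->
  (forall z, -oo < f z)%E ->
  (forall x y, (x, y) = (x1, y1) \/ (x, y) = (x2, y2) ->
     [/\ prox_set f p g x y, enorm y <= eps,
         enorm (g^-1 *: dmap p (x - y)) <= eps & (f y < eps%:E)%E]) ->
  - (rho * g * enorm (y2 - y1) `^ q) <=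
    dotp (dmap p (x1 - y1) - dmap p (x2 - y2)) (y1 - y2).
Proof.
move=> g0 f0 fpr fNy H.
have [P1 e1 z1 f1] := H x1 y1 (or_introl erefl).
have [P2 e2 z2 f2] := H x2 y2 (or_intror erefl).
have fin y : (f y < eps%:E)%E -> f y \is a fin_num.
  by move=> fy; rewrite fin_numElt fNy (lt_trans fy (ltry _)).
have L1 := frechet_limiting (prox_frechet_subdiff p12 g0 (fin _ f1) fNy P1).
have L2 := frechet_limiting (prox_frechet_subdiff p12 g0 (fin _ f2) fNy P2).
have := fpr y2 _ _ L2 _ _ y1; have := fpr y1 _ _ L1 _ _ y2.
rewrite !subr0 f0 add0e => /(_ e1 z1 f1 e2) h1 /(_ e2 z2 f2 e1) h2.
rewrite -(fineK (fin _ f1)) -(fineK (fin _ f2)) -EFinD lee_fin in h1.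
rewrite -(fineK (fin _ f1)) -(fineK (fin _ f2)) -EFinD lee_fin in h2.
move: h2 h1; rewrite !(dotpZl g^-1) dotpBl (enormBC y1).
have -> : dotp (dmap p (x1 - y1)) (y2 - y1) = - dotp (dmap p (x1 - y1)) (y1 - y2).
  by rewrite -dotpNr opprB.
move: (fine _) (fine _) (dotp _ _) (dotp _ _) (_ `^ q).
clear - g0 => s1 s2 D1 D2 A h2 h1.
have : g * (g^-1 * D2 - g^-1 * D1 - rho * A) <= g * 0 by rewrite ler_pM2l//; lra.
have -> : g * (g^-1 * D2 - g^-1 * D1 - rho * A) = D2 - D1 - rho * g * A.
  by field; rewrite gt_eqF.
lra.
Qed.

(** * Existence and localization of proximal points under calmness *)

Section Calm.
Variables (f : V -> \bar R) (M g : R).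
Hypotheses (M0 : 0 < M) (g0 : 0 < g) (gM : g < 2 `^ (1 - p) / (M * p)).
Hypotheses (fcalm : p_calm f 0 M p) (f0 : f 0 = 0%E).
Hypotheses (fNy : forall z, (-oo < f z)%E) (flsc : lsc f).

Let p0 : 0 < p. Proof. by case/andP: p12; lra. Qed.
Let pg0 : 0 < p * g. Proof. exact: mulr_gt0. Qed.

Lemma calm_lower y : ((- (M * enorm y `^ p))%:E <= f y)%E.
Proof.
have [->|y0] := eqVneq y 0; first by rewrite f0 enorm0 powR0 ?gt_eqF// mulr0 oppr0.
have := fcalm y0; rewrite f0 subr0; case: (f y) (fNy y) => [s||]// _.
- by rewrite -EFinD lte_fin lee_fin; lra.
- by rewrite leey.
Qed.

(** The calmness bound on [g], rewritten as positivity of the coefficient of |x-y|^p in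
    [prox_objective_lower]. *)
Lemma calm_gap : M * 2 `^ (p - 1) < (p * g)^-1.
Proof.
have c0 : 0 < (2 : R) `^ (p - 1) by exact: powR_gt0.
move: gM; have -> : 1 - p = - (p - 1) by ring.
rewrite powRN ltr_pdivlMr ?mulr_gt0// -[_^-1]mul1r ltr_pdivlMr// => h.
rewrite -[(p * g)^-1]mul1r ltr_pdivlMr//; apply: le_lt_trans h.
by rewrite le_eqVlt; apply/orP; left; apply/eqP; ring.
Qed.

(** Calmness gives f y >= - M |y|^p, and |y|^p <= 2^(p-1) (|x-y|^p + |x|^p) by convexity. *)
Lemma prox_objective_lower x y :
  ((((p * g)^-1 - M * 2 `^ (p - 1)) * enorm (x - y) `^ p
    - M * 2 `^ (p - 1) * enorm x `^ p)%:E
   <= f y + (enorm (x - y) `^ p / (p * g))%:E)%E.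
Proof.
apply: le_trans (leeD2r _ (calm_lower y)); rewrite -EFinD lee_fin.
have yle := enorm_le_dist x y.
have p1 : 1 <= p by case/andP: p12; lra.
have := powR_convex_mean p1 (enorm_ge0 (x - y)) (enorm_ge0 x).
have := ge0_ler_powR (ltW p0) _ _ yle; rewrite !nnegrE addr_ge0// => /(_ (enorm_ge0 y) isT).
move=> h1 h2; have := ler_wpM2l (ltW M0) (le_trans h1 h2).
move: (_ `^ p) (_ `^ p) (_ `^ p) (_ `^ (p - 1)) (_^-1).
by move=> *; lra.
Qed.

(** Holds for every [y] doing at least as well as 0, so it serves both to localize minimizers and,
    by contraposition, to give coercivity. [C] is the p-th root of the ratio of the coefficients of
    |x|^p and |x-y|^p. *)
Lemma prox_radius : exists2 C, 0 <= C & forall x y,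
  (f y + (enorm (x - y) `^ p / (p * g))%:E <=
   f 0 + (enorm (x - 0) `^ p / (p * g))%:E)%E -> enorm (x - y) <= C * enorm x.
Proof.
have gap := calm_gap; set K := M * _ in gap.
have K0 : 0 <= K by rewrite mulr_ge0 ?powR_ge0// ltW.
have k0 : 0 < (p * g)^-1 - K by lra.
exists ((((p * g)^-1 + K) / ((p * g)^-1 - K)) `^ p^-1); first exact: powR_ge0.
move=> x y /(le_trans (prox_objective_lower x y)).
rewrite f0 add0e subr0 lee_fin -/K => h.
have pK (t : R) : 0 <= t -> t = (t `^ p) `^ p^-1.
  by move=> t0; rewrite -powRrM divff ?gt_eqF// powRr1.
rewrite (pK _ (enorm_ge0 (x - y))) (pK _ (enorm_ge0 x)) -powRM ?powR_ge0//; last first.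
  by rewrite divr_ge0 ?(ltW k0)//; lra.
apply: ge0_ler_powR; rewrite ?nnegrE ?powR_ge0 ?invr_ge0 ?(ltW p0)//.
  by rewrite mulr_ge0 ?powR_ge0// divr_ge0 ?(ltW k0)//; lra.
by rewrite mulrAC ler_pdivlMr//; lra.
Qed.

Lemma prox_exists x : exists y, prox_set f p g x y.
Proof.
have [C C0 hC] := prox_radius; have gap := calm_gap.
apply: (@lsc_coercive_attains_min _ _ _ (- (M * 2 `^ (p - 1) * enorm x `^ p))
         ((C + 1) * enorm x) 0).
- exact: lsc_add_powR_dist.
- move=> y; apply: le_trans (prox_objective_lower x y); rewrite lee_fin lerDr.
  by rewrite mulr_ge0 ?powR_ge0// subr_ge0 ltW.
- by rewrite f0 add0e ltry.
- by rewrite enorm0 mulr_ge0// addr_ge0.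
move=> y ry; rewrite ltNge; apply/negP => /hC h.
have := enorm_le_dist x y.
lra.
Qed.

Lemma prox_near (eps : R) : 0 < eps -> exists2 d, 0 < d &
  forall x, enorm x < d -> enorm x <= eps /\ forall y, prox_set f p g x y ->
    [/\ enorm y <= eps, enorm (x - y) <= eps,
        enorm (g^-1 *: dmap p (x - y)) <= eps & (f y < eps%:E)%E].
Proof.
move=> e0; have [C C0 hC] := prox_radius; have /andP[p10 _] := p1_gt0_le1 p12.
have gV : 0 < g^-1 by rewrite invr_gt0.
have pgV : 0 < (p * g)^-1 by rewrite invr_gt0.
have e20 : 0 < eps / 2 by rewrite divr_gt0.
have [d1 d10 h1] := powR_small p10 gV e0.
have [d2 d20 h2] := powR_small p0 pgV e20.
have C1 : 0 < C + 1 by rewrite ltr_wpDl.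
(* Since |x-y| + |x| <= (C+1) |x|, the first bound controls [y], x - y and J(x-y) / g; [d2] controls
   f y, which is at most |x|^p / (p g) by comparison with 0. *)
exists (Num.min (Num.min eps d1 / (C + 1)) d2).
  by rewrite lt_min d20 divr_gt0// lt_min e0.
move=> x; rewrite lt_min ltr_pdivlMr// lt_min => /andP[/andP[xe xd1] xd2].
have xC : enorm x * (C + 1) = C * enorm x + enorm x by ring.
have Cx : 0 <= C * enorm x by exact: mulr_ge0.
have x0 := enorm_ge0 x.
split; first by lra.
move=> y yx; have hu := hC _ _ (yx 0).
have yle := enorm_le_dist x y.
split; [lra|lra| |].
  rewrite enormZ gtr0_norm// enorm_dmap//; apply: h1 => //; lra.
apply: (@le_lt_trans _ _ (enorm x `^ p / (p * g))%:E).
  have := yx 0; rewrite f0 add0e subr0; apply: le_trans; rewrite leeDl// lee_fin.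
  by rewrite divr_ge0 ?powR_ge0// ltW.
rewrite lte_fin mulrC; apply: le_lt_trans (h2 _ _ (ltW xd2)) _ => //; lra.
Qed.

End Calm.
End Estimates.

(** * Hoelder continuity of the proximal map and of the envelope gradient *)

Unset Implicit Arguments.
Set Strict Implicit.

Theorem theorem7 (R : realType) (n : nat) (p q M eps rho : R)
    (phi : 'rV[R]_n -> \bar R) :
  1 < p <= 2 -> proper_fun phi -> lsc phi ->
  0 < M -> p_calm phi 0 M p -> phi 0 = 0%E ->
  2 <= q -> 0 < eps -> eps < 1 / 2 -> 0 < rho ->
  limiting_subdiff phi 0 0 -> prox_regular phi 0 0 q eps rho ->
  forall gamma : R, 0 < gamma ->
  gamma < Num.min (2 `^ (1 - p) / (M * p)) (kappa p * (2 * eps) `^ (p - 2) / rho) ->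
  let Lp := (4 * eps * (kappa p + 1) /
             (kappa p - rho * gamma * (2 * eps) `^ (2 - p))) `^ (1 / q) in
  let cLp := 2 `^ (2 - p) / gamma * ((2 * eps) `^ ((q - 1) / q) + Lp) `^ (p - 1) in
  exists U : set 'rV[R]_n,
    eopen U /\ U 0 /\ U `<=` cball 0 eps /\
    exists P G : 'rV[R]_n -> 'rV[R]_n,
      (forall x, U x -> prox_set phi p gamma x = [set P x]) /\
      (forall x1 x2, U x1 -> U x2 ->
         enorm (P x2 - P x1) <= Lp * enorm (x2 - x1) `^ (1 / q)) /\
      (forall x, U x -> frechet_grad (moreau_env phi p gamma) x (G x)) /\
      (forall x1 x2, U x1 -> U x2 ->
         enorm (G x2 - G x1) <= cLp * enorm (x2 - x1) `^ ((p - 1) / q)).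
Proof.
move=> p12 [fNy _] flsc M0 fcalm f0 q2 e0 e12 rho0 _ fpr g g0.
rewrite lt_min => /andP[gM gk] Lp cLp.
have /andP[p10 p11] := p1_gt0_le1 p12.
have q0 : 0 < q by lra.
have qV : 0 < 1 / q by rewrite divr_gt0.
have E0 : 0 < 2 * eps by lra.
have kp := kappa_le p12.
(* The second bound on [gamma] makes the denominator in [Lp] positive. *)
have bk : rho * g * (2 * eps) `^ (2 - p) < kappa p.
  move: gk; have -> : p - 2 = - (2 - p) by ring.
  by rewrite powRN ltr_pdivlMr// [g * _]mulrC ltr_pdivlMr// powR_gt0.
have b0 : 0 <= rho * g by rewrite mulr_ge0 ?(ltW rho0) ?(ltW g0).
have k0 : 0 < kappa p by apply: le_lt_trans bk; rewrite mulr_ge0 ?powR_ge0.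
have Lp0 : 0 < Lp.
  by rewrite powR_gt0// divr_gt0 ?subr_gt0// !mulr_gt0// addr_gt0.
have [d d0 hd] := prox_near p12 M0 g0 gM fcalm f0 fNy e0.
have hex := prox_exists p12 M0 g0 gM fcalm f0 fNy flsc.
pose P x := xget 0 (prox_set phi p g x).
have PP x : prox_set phi p g x (P x).
  by have [y yx] := hex x; apply: (xgetI 0 yx).
(* Stated for arbitrary minimizers rather than for [P], so that x1 = x2 yields uniqueness. *)
have holder x1 x2 y1 y2 : enorm x1 < d -> enorm x2 < d ->
    prox_set phi p g x1 y1 -> prox_set phi p g x2 y2 ->
    enorm (y2 - y1) <= Lp * enorm (x2 - x1) `^ (1 / q).
  move=> xd1 xd2 yx1 yx2.
  have [_ /(_ _ yx1)[y1e u1e z1e f1e]] := hd _ xd1.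
  have [_ /(_ _ yx2)[y2e u2e z2e f2e]] := hd _ xd2.
  apply: (monotone_holder p12 e0 e12 q2 b0 kp bk); [lra|lra| |].
    by apply: le_trans (enormB_le _ _) _; lra.
  by apply: (prox_regular_monotone p12 g0 f0 fpr fNy) => x y [] [-> ->].
exists [set x | enorm x < d]; split.
  move=> x /= xd; exists (d - enorm x); split; first by rewrite subr_gt0.
  by move=> y yx; have := enormD_le (y - x) x; rewrite subrK; lra.
split; first by rewrite /= enorm0.
split; first by move=> x /= /hd[xe _]; rewrite /cball/= subr0.
exists P, (fun x => g^-1 *: dmap p (x - P x)).
have PH x1 x2 : enorm x1 < d -> enorm x2 < d ->
    enorm (P x2 - P x1) <= Lp * enorm (x2 - x1) `^ (1 / q).
  by move=> xd1 xd2; exact: holder.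
split.
  move=> x /= xd; rewrite eqEsubset; split=> [y yx|_ ->]; last exact: PP.
  have := holder _ _ _ _ xd xd (PP x) yx.
  rewrite subrr enorm0 powR0 ?gt_eqF// mulr0 => h.
  by apply/eqP; rewrite -subr_eq0 -enorm_eq0 eq_le h enorm_ge0.
split; first exact: PH.
split.
  move=> x /= xd; have dx : 0 < d - enorm x by rewrite subr_gt0.
  have near y : enorm (y - x) < d - enorm x -> enorm y < d.
    by move=> yx; have := enormD_le (y - x) x; rewrite subrK; lra.
  apply: moreau_env_frechet_grad => //.
    exists (d - enorm x) => // y /near yd; split; first exact: PP.
    have [_ /(_ _ (PP y))[_ _ _ fy]] := hd _ yd.
    by rewrite fin_numElt fNy (lt_trans fy (ltry _)).
  (* The Hoelder bound on [P] supplies the continuity required for differentiating the envelope. *)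
  move=> e e_gt0; have [d' d'0 hd'] := powR_small qV Lp0 e_gt0.
  exists (Num.min (d - enorm x) d'); first by rewrite lt_min dx.
  move=> y; rewrite lt_min => /andP[/near yd /ltW yd'].
  exact: le_trans (PH _ _ xd yd) (hd' _ (enorm_ge0 _) yd').
move=> x1 x2 /= xd1 xd2; have a_le := PH _ _ xd1 xd2.
have [x1e _] := hd _ xd1; have [x2e _] := hd _ xd2.
rewrite -scalerBr enormZ gtr0_norm ?invr_gt0//.
have s0 := enorm_ge0 (x2 - x1).
have s_le : enorm (x2 - x1) <= 2 * eps.
  by apply: le_trans (enormB_le _ _) _; lra.
(* Writing s = s^((q-1)/q) s^(1/q) with s <= 2 eps puts the increment of [x] on the same Hoelder
   scale as that of [P]; this is the first summand inside [cLp]. *)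
have split_s : enorm (x2 - x1) <=
    (2 * eps) `^ ((q - 1) / q) * enorm (x2 - x1) `^ (1 / q).
  have E : (q - 1) / q + 1 / q = 1 by field; rewrite gt_eqF.
  rewrite -[leLHS]powRr1// -{1}E powRD ?E ?oner_eq0//.
  rewrite ler_wpM2r ?powR_ge0//; apply: ge0_ler_powR; rewrite ?nnegrE ?(ltW E0)//.
  by rewrite divr_ge0 ?(ltW q0)//; lra.
set W := (2 * eps) `^ ((q - 1) / q) in split_s.
have u_le : enorm (x2 - P x2 - (x1 - P x1)) <=
    (W + Lp) * enorm (x2 - x1) `^ (1 / q).
  have -> : x2 - P x2 - (x1 - P x1) = (x2 - x1) - (P x2 - P x1).
    by rewrite !opprD !opprK addrACA.
  by apply: le_trans (enormB_le _ _) _; rewrite mulrDl lerD.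
have WL : 0 <= W + Lp by rewrite addr_ge0 ?powR_ge0.
have -> : (p - 1) / q = 1 / q * (p - 1) by field; rewrite gt_eqF.
rewrite powRrM /cLp -/W -mulrA -powRM ?powR_ge0// mulrAC [leRHS]mulrC.
rewrite ler_pM2l ?invr_gt0//; apply: le_trans (dmap_holder p12 _ _) _.
rewrite ler_pM2l ?powR_gt0//; apply: ge0_ler_powR; rewrite ?nnegrE ?(ltW p10)//.
by rewrite mulr_ge0 ?powR_ge0.
Qed.
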